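(* Let $k\ge 2$ be an integer and $0<\varepsilon<1$. Suppose $n$ is sufficiently large (depending on $k$ and $\varepsilon$) and set $q=\frac{\varepsilon^4 n}{10^5k^2\log n}$ and $t=\frac{\varepsilon^7 n}{10^{11}k^5}$. Let $G$ be an incomparability graph on $n$ vertices with no copy of $K_k[q]$. Then there exists a partition $V(G)=V_0\sqcup V_1\sqcup\dots\sqcup V_m$ such that $|V_0|\le\varepsilon n$, $|V_1|=|V_2|=\dots=|V_m|=t$, and all but at most $\varepsilon m^2$ of the pairs $(V_i,V_j)$, $1\le i<j\le m$, are homogeneous.
   Context: All graphs are finite and simple. The incomparability graph of a partially ordered set $(P,\prec)$ is the graph with vertex set $P$ in which two distinct elements are adjacent if and only if they are incomparable in $P$; an incomparability graph is a graph arising this way. $K_k[q]$ is the complete $k$-partite graph with all parts of size $q$; a copy means a not necessarily induced subgraph. A pair $(V_i,V_j)$ of disjoint vertex sets is homogeneous if the bipartite graph $G[V_i,V_j]$ is either empty or complete. Floor signs are omitted: non-integer values of $q$ and $t$ are read as $\lfloor q\rfloor$, $\lfloor t\rfloor$. $\log$ is the natural logarithm. *)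

(* Defs.v *)
From HB Require Import structures.
From mathcomp Require Import all_boot all_order all_algebra.
From mathcomp Require Import reals exp.

Set Implicit Arguments.
Unset Strict Implicit.
Unset Printing Implicit Defensive.

Import Order.TTheory.

Record sgraph := SGraph {
  vertex :> finType;
  adj : rel vertex;
  adj_sym : symmetric adj;
  adj_irrefl : irreflexive adj }.

(* Every element is comparable with itself, so [><] is already irreflexive
   and adjacency needs no explicit [x != y]. *)
Section IncomparabilityGraph.
Variables (d : Order.disp_t) (P : finPOrderType d).

Definition incomparable : rel P := fun x y => (x >< y)%O.

Lemma incomparable_sym : symmetric incomparable.
Proof. by move=> x y; rewrite /incomparable comparable_sym. Qed.

Lemma incomparable_irrefl : irreflexive incomparable.
Proof. by move=> x; rewrite /incomparable comparablexx. Qed.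

Definition incomparability_graph : sgraph :=
  SGraph incomparable_sym incomparable_irrefl.

End IncomparabilityGraph.

(* The vertex (i, a) is the a-th vertex of the i-th part. *)
Section CompleteMultipartite.
Variables k q : nat.

Definition multipartite_adj : rel ('I_k * 'I_q) := fun u v => u.1 != v.1.

Lemma multipartite_adj_sym : symmetric multipartite_adj.
Proof. by move=> u v; rewrite /multipartite_adj eq_sym. Qed.

Lemma multipartite_adj_irrefl : irreflexive multipartite_adj.
Proof. by move=> u; rewrite /multipartite_adj eqxx. Qed.

Definition complete_multipartite : sgraph :=
  SGraph multipartite_adj_sym multipartite_adj_irrefl.

End CompleteMultipartite.

Definition has_copy (H G : sgraph) : Prop :=
  exists2 f : H -> G, injective f & forall x y, adj x y -> adj (f x) (f y).

Definition homogeneous (G : sgraph) (A B : {set G}) : bool :=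
  [forall x in A, forall y in B, ~~ adj x y] ||
  [forall x in A, forall y in B, adj x y].

(* Main.v *)
(** Call [y << x] when [y < x] and at least [t] elements lie strictly between
    them inside a given set [S]; this is a strict order.  A chain
    [y_0 << ... << y_l] yields blocks [B_i] of size [t] between [y_i] and
    [y_(i+1)], each lying entirely below the next: a thick chain.  Removing
    thick chains of [l] blocks greedily partitions the poset up to a small
    rest, and two thick chains [B], [B'] have few inhomogeneous pairs: if some
    element of [B_i] is below some element of [B'_j], then [B_(i-1)] is
    entirely below [B'_(j+1)], so each antidiagonal [i + j = const] contains
    at most two such pairs.

    If [S] has no thick chain then, by Mirsky's argument, it has a large subset
    [X] in which every interval has fewer than [t] elements.  Without [K_k[q]]
    such an [X] has at most [O(k^2 q log q + k^4 t)] elements.  Indeed one can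
    peel off [X] layers [W_0], [W_1], ... of size [O(k^2 q)] so that the downset
    of a small set more than doubles from each layer to the previous one.
    After [log q] layers every single element lies above at least [q] elements
    of every earlier layer, and double counting the pairs [y < z] below an
    element [x] that survives all layers produces a long interval [(y, x)]. *)

Require Import Defs.
From HB Require Import structures.
From mathcomp Require Import all_boot all_order all_algebra.
From mathcomp Require Import reals exp.
From mathcomp Require Import zify ring lra.

Set Implicit Arguments.
Unset Strict Implicit.
Unset Printing Implicit Defensive.

Import Order.TTheory.

(** * Downsets and families of mutually incomparable sets *)

Section Downsets.
Variables (d : Order.disp_t) (P : finPOrderType d).
Implicit Types (A B N S T : {set P}) (C : seq {set P}).

Definition below A : {set P} := [set y | [exists x in A, (y < x)%O]].

Lemma belowP A y : reflect (exists2 x, x \in A & (y < x)%O) (y \in below A).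
Proof. by rewrite inE; apply: exists_inP. Qed.

Lemma belowS A B : A \subset B -> below A \subset below B.
Proof.
move=> /subsetP sAB; apply/subsetP=> y /belowP[x xA yx].
by apply/belowP; exists x; first exact: sAB.
Qed.

Lemma belowU A B : below (A :|: B) = below A :|: below B.
Proof.
apply/setP=> y; rewrite in_setU; apply/belowP/orP => [[x]|].
  by rewrite inE => /orP[] xA yx; [left|right]; apply/belowP; exists x.
by case=> /belowP[x xA yx]; exists x; rewrite // inE xA ?orbT.
Qed.

Lemma below0 : below set0 = set0.
Proof. by apply/setP=> y; rewrite [RHS]inE; apply/belowP => -[x]; rewrite inE. Qed.

Lemma below_trans A B : B \subset below A -> below B \subset below A.
Proof.
move=> /subsetP sB; apply/subsetP=> y /belowP[x /sB /belowP[z zA xz] yx].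
by apply/belowP; exists z => //; apply: lt_trans xz.
Qed.

Definition incomparable_sets A B := [forall x in A, forall y in B, (x >< y)%O].

Lemma incomparable_setsP A B :
  reflect {in A & B, forall x y, (x >< y)%O} (incomparable_sets A B).
Proof.
apply: (iffP forall_inP) => h x; last by move=> xA; apply/forall_inP=> y; exact: h.
by move=> y xA yB; move/forall_inP: (h x xA); apply.
Qed.

(** The order-theoretic form of having no copy of $K_k[q]$. Parts may be larger than [q], and their
    disjointness is automatic because no element is incomparable with itself. *)
Definition cofree (k q : nat) := forall Bs : seq {set P},
  size Bs = k -> all (fun B => q <= #|B|) Bs -> pairwise incomparable_sets Bs -> False.

Lemma subset_of_card A n : n <= #|A| -> exists2 B : {set P}, B \subset A & #|B| = n.
Proof.
move=> nA; exists [set x in take n (enum A)].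
  by apply/subsetP=> x; rewrite inE => /mem_take; rewrite mem_enum.
rewrite cardsE (card_uniqP _) ?take_uniq ?enum_uniq // size_takel //.
by rewrite -cardE.
Qed.

Lemma leq_sum_seq_const (I : eqType) (s : seq I) (F : I -> nat) m :
  (forall i, i \in s -> F i <= m) -> \sum_(i <- s) F i <= size s * m.
Proof.
elim: s => [|i s IHs] h; first by rewrite big_nil.
rewrite big_cons mulSn leq_add ?h ?mem_head //.
by apply: IHs => j js; apply: h; rewrite inE js orbT.
Qed.

End Downsets.

Arguments incomparable_sets {d P}.

(** * Expansion in posets without large incomparable sets *)

Section Expansion.
Variables (d : Order.disp_t) (P : finPOrderType d) (idx : P -> nat) (top : nat).
Hypothesis idx_inj : injective idx.
Hypothesis idx_mono : forall x y, (x < y)%O -> idx x < idx y.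
Hypothesis idx_top : forall x, idx x < top.
Variables k q : nat.
Hypothesis k_gt0 : 0 < k.
Hypothesis q_gt0 : 0 < q.
Implicit Types (A B N S T X Z : {set P}) (C : seq {set P}) (F : {set {set P}}).

(** A block is a set that fails to expand into any cell of [C]. The lower size bound leaves [q]
    elements after the loss of [q] others; the upper one leaves room to absorb a set of at most [q]
    elements into one of fewer than [2 * q], and caps [2 * #|T|] by [6 * q]. *)
Definition block C T :=
  (2 * q <= #|T| <= 3 * q) && all (fun N => #|below T :&: N| <= 2 * #|T|) C.

Definition expands C A := has (fun N => 2 * #|A| < #|below A :&: N|) C.

Lemma expands_sub C C' A : {subset C <= C'} -> expands C A -> expands C' A.
Proof. by move=> sC /hasP[N NC h]; apply/hasP; exists N => //; exact: sC. Qed.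

(** Delete a largest non-expanding set [M] of at most [3 * q] elements. Without blocks it has fewer
    than [2 * q] elements, so a non-expanding [A] of at most [q] elements in the rest could be added
    to it, against maximality. *)
Lemma expanding_remainder C S :
  (forall T, T \subset S -> ~~ block C T) ->
  exists S', [/\ S' \subset S, #|S :\: S'| <= 2 * q &
    forall A, A \subset S' -> 0 < #|A| <= q -> expands C A].
Proof.
move=> noblock.
pose nonexp A := [&& A \subset S, #|A| <= 3 * q &
  all (fun N => #|below A :&: N| <= 2 * #|A|) C].
have ne0 : nonexp set0.
  by rewrite /nonexp sub0set cards0 /=; apply/allP=> N _; rewrite below0 set0I cards0.
case: (arg_maxnP (fun A : {set P} => #|A|) ne0) => M /and3P[MS M3 Mall] Mmax.
have M2 : #|M| < 2 * q.
  rewrite ltnNge; apply/negP=> M2; move: (noblock M MS).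
  by rewrite /block M2 M3 Mall.
exists (S :\: M); split; first exact: subsetDl.
  rewrite setDDr setDv set0U; apply: leq_trans (ltnW M2).
  by apply: subset_leq_card; apply: subsetIr.
move=> A AS /andP[A0 Aq]; rewrite /expands -[has _ _]negbK -all_predC.
apply/negP=> /allP h.
have dMA : [disjoint M & A].
  rewrite disjoint_sym; apply/pred0P => x; apply/negbTE/negP => /andP[/= xA xM].
  by move/subsetP: AS => /(_ x xA); rewrite inE xM.
have cMA : #|M :|: A| = #|M| + #|A|.
  by rewrite cardsU (disjoint_setI0 dMA) cards0 subn0.
suff /Mmax : nonexp (M :|: A) by rewrite cMA; lia.
apply/and3P; split.
- by rewrite subUset MS (subset_trans AS) ?subsetDl.
- by rewrite cMA; lia.
apply/allP=> N NC; rewrite cMA belowU setIUl.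
apply: leq_trans (leq_card_setU _ _).1 _.
by move/allP: Mall => /(_ N NC); move: (h N NC); rewrite /= -leqNgt; lia.
Qed.

(** * Packings of disjoint blocks *)

Definition packing C Z F :=
  trivIset F && [forall T in F, block C T && (T \subset Z)].

Lemma packingP C Z F : reflect
  (trivIset F /\ forall T, T \in F -> block C T /\ T \subset Z) (packing C Z F).
Proof.
apply: (iffP andP) => -[tF h]; split=> //.
  by move=> T TF; apply/andP; move/forall_inP: h; apply.
by apply/forall_inP=> T /h/andP.
Qed.

Definition packing_number C Z := \max_(F | packing C Z F) #|F|.

Lemma packing0 C Z : packing C Z set0.
Proof.
apply/packingP; split; last by move=> T; rewrite inE.
by rewrite /trivIset /cover !big_set0 cards0.
Qed.

Lemma packing_number_attained C Z :
  exists2 F, packing C Z F & packing_number C Z = #|F|.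
Proof.
have h : 0 < #|[pred F | packing C Z F]|.
  by apply/card_gt0P; exists set0; apply: packing0.
by case: (eq_bigmax_cond (fun F : {set {set P}} => #|F|) h) => F pF e; exists F.
Qed.

Lemma packing_number_max C Z F : packing C Z F -> #|F| <= packing_number C Z.
Proof. by move=> pF; apply: (@leq_bigmax_cond _ (packing C Z) (fun F => #|F|)). Qed.

Lemma packing_number0 C : packing_number C set0 = 0.
Proof.
case: (packing_number_attained C set0) => F /packingP[_ h] ->.
apply/eqP; rewrite cards_eq0; apply/set0Pn => -[T /h[/andP[/andP[T2 _] _]]].
by rewrite subset0 => /eqP T0; move: T2; rewrite T0 cards0; lia.
Qed.

(** Disjointness puts [x] in at most one block of a packing, so deleting [x] destroys at most that
    block. *)
Lemma packing_numberD1 C Z x :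
  packing_number C Z <= (packing_number C (Z :\ x)).+1.
Proof.
case: (packing_number_attained C Z) => F /packingP[tF h] ->.
rewrite (cardsD1 (pblock F x)) -add1n leq_add ?leq_b1 //.
apply: packing_number_max; apply/packingP; split.
  by apply: trivIsetS tF; apply: subsetDl.
move=> T /setD1P[Tx TF]; have [bT TZ] := h T TF; split=> //.
apply/subsetP=> y yT; rewrite !inE (subsetP TZ) // andbT.
by apply: contraNneq Tx => <-; rewrite (def_pblock tF TF yT).
Qed.

Lemma packing_maximal C Z F T : packing C Z F -> #|F| = packing_number C Z ->
  T \subset Z :\: cover F -> ~~ block C T.
Proof.
move=> pF maxF TZ; apply/negP=> bT; have /packingP[tF h] := pF.
have T0 : T != set0.
  by apply: contraTneq bT => ->; rewrite /block cards0; lia.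
have dT T' : T' \in F -> [disjoint T & T'].
  move=> T'F; apply/pred0P=> x; apply/negbTE/negP=> /andP[/= xT xT'].
  move/subsetP: TZ => /(_ x xT); rewrite inE => /andP[/negP[]].
  by apply/bigcupP; exists T'.
have TF : T \notin F.
  apply/negP=> /dT /disjoint_setI0; rewrite setIid => /eqP; exact/negP.
suff /packing_number_max : packing C Z (T |: F) by rewrite cardsU1 TF -maxF; lia.
apply/packingP; split.
  apply/trivIsetP=> A B /setU1P[->|AF] /setU1P[->|BF]; rewrite ?eqxx //.
  - by move=> _; apply: dT.
  - by move=> _; rewrite disjoint_sym; apply: dT.
  by move/trivIsetP: tF; apply.
move=> A /setU1P[->|/h//]; split=> //; apply: subset_trans TZ _; exact: subsetDl.
Qed.

(** * Runs along the linear extension *)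

Definition slice X c e := [set x in X | c <= idx x < e].

Lemma packing_number_slice C X c e :
  packing_number C (slice X c e.+1) <= (packing_number C (slice X c e)).+1.
Proof.
have [[x /eqP xe]|h] := altP (@existsP P (fun x => idx x == e)).
  have -> : slice X c e = slice X c e.+1 :\ x.
    apply/setP=> y; rewrite !inE -(inj_eq idx_inj) xe.
    by case: (y \in X) => //=; lia.
  exact: packing_numberD1.
have -> : slice X c e.+1 = slice X c e; last exact: leqnSn.
apply/setP=> y; rewrite !inE; congr andb.
have : idx y != e by apply: contra h => h; apply/existsP; exists y.
by lia.
Qed.

(* [lab] labels positions of the linear extension by the batches of the previous
   stage; [lab e - lab c + 1] bounds the number of batches that a run from [c]
   to [e] meets.  Scaling the number of blocks of a run by it keeps the total
   cost linear in the number of runs plus the number of batches. *)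
Definition threshold (lab : nat -> nat) c e := 6 * k * (lab e - lab c).+1.

(** Stop at the first [e] where the packing number reaches the threshold. It starts at zero and
    rises by at most one per position, while the threshold is positive and nondecreasing in [e], so
    the two are equal there: enough blocks to extend a stack, and no more than the cost estimate
    allows. If the threshold is never reached, the run extends to [top]. *)
Lemma run_exists C X lab c : {homo lab : m n / m <= n} -> c <= top ->
  exists e F, [/\ c <= e <= top, packing C (slice X c e) F,
    forall T, T \subset slice X c e :\: cover F -> ~~ block C T,
    #|F| <= threshold lab c e &
    #|F| = threshold lab c e \/ e = top].
Proof.
move=> labm ct; pose nu e := packing_number C (slice X c e).
have nuc : nu c = 0.
  rewrite /nu (_ : slice X c c = set0) ?packing_number0 //.
  by apply/setP=> y; rewrite !inE; apply/negP=> /andP[_]; lia.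
suff [e [ce le_e or_e]] : exists e, [/\ c <= e <= top, nu e <= threshold lab c e &
    nu e = threshold lab c e \/ e = top].
  have [F pF eF] := packing_number_attained C (slice X c e).
  exists e, F; rewrite -eF; split=> // T; exact: packing_maximal.
have [h|h] := altP (@hasP _ (fun e => threshold lab c e <= nu e) (index_iota c top.+1)).
  have ex_e : exists e, (c <= e <= top) && (threshold lab c e <= nu e).
    by case: h => e; rewrite mem_index_iota ltnS => ce he; exists e; rewrite ce.
  have [e /andP[et he] emin] := ex_minnP ex_e.
  exists e; suff le_e : nu e <= threshold lab c e.
    by split=> //; left; apply/eqP; rewrite eqn_leq le_e.
  have ce : c != e.
    by apply: contraTneq he => <-; rewrite nuc /threshold; lia.
  case: e et he emin ce => [|e] et he emin ce; first by lia.
  have {emin} : nu e < threshold lab c e.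
    rewrite ltnNge; apply/negP=> h'; suff : e.+1 <= e by lia.
    by apply: emin; rewrite h'; lia.
  have := packing_number_slice C X c e; rewrite -/(nu e) -/(nu e.+1).
  have : threshold lab c e <= threshold lab c e.+1.
    by rewrite leq_mul2l ltnS leq_sub2r ?orbT // labm.
  by lia.
exists top; rewrite leqnn ct; split=> //; last by right.
move/hasPn: h => /(_ top); rewrite mem_index_iota ct ltnSn => /(_ isT).
by rewrite -ltnNge => /ltnW.
Qed.

(** * Stacking runs towards a complete multipartite graph *)

Definition mono_on (lab : nat -> nat) A :=
  {in A &, forall x y, lab (idx x) = lab (idx y)}.

(* The runs completed so far, whose cells are listed in [C], provide [p] parts of
   a [K_k[q]]: any [k - p] further parts that lie later in the linear extension
   and have few elements of each cell below them extend to a full copy. *)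
Definition stack p c C := forall Bs : seq {set P}, size Bs + p = k ->
  (forall B, B \in Bs -> [/\ q <= #|B|, forall x, x \in B -> c <= idx x
     & forall N, N \in C -> #|below B :&: N| <= 6 * q]) ->
  pairwise incomparable_sets Bs -> False.

Definition cells (lab : nat -> nat) c e S :=
  [seq [set x in S | lab (idx x) == i] | i <- iota (lab c) (lab e - lab c).+1].

Lemma card_cells lab X c e S B m : {homo lab : a b / a <= b} ->
  S \subset slice X c e ->
  (forall N, N \in cells lab c e S -> #|B :&: N| <= m) ->
  #|B :&: S| <= m * (lab e - lab c).+1.
Proof.
move=> labm /subsetP SX h.
apply: (@leq_trans (\sum_(i <- iota (lab c) (lab e - lab c).+1)
   #|B :&: [set x in S | lab (idx x) == i]|)).
  rewrite (eq_bigr (fun i => \sum_(x in B :&: S) (lab (idx x) == i))); last first.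
    move=> i _; transitivity (\sum_(x in B :&: S | lab (idx x) == i) 1).
      by rewrite -sum1_card; apply: eq_bigl => x; rewrite !inE andbA.
    by rewrite big_mkcondr; apply: eq_bigr => x _; case: (_ == _).
  rewrite exchange_big -sum1_card; apply: leq_sum => x.
  rewrite inE => /andP[_ /SX]; rewrite inE => /and3P[_ cx xe].
  have xi : lab (idx x) \in iota (lab c) (lab e - lab c).+1.
    by rewrite mem_iota; have := labm _ _ cx; have := labm _ _ (ltnW xe); lia.
  by rewrite (big_rem _ xi) /= eqxx.
rewrite mulnC -{2}(size_iota (lab c) (lab e - lab c).+1).
  by apply: leq_sum_seq_const => i ii; apply: h; apply/mapP; exists i.
Qed.

Lemma stack0 : cofree P k q -> stack 0 0 [::].
Proof.
move=> free Bs; rewrite addn0 => sB h; apply: free => //.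
by apply/allP=> B /h[].
Qed.

(** The sets of [Bs] have few elements of each cell below them, hence few of [cover F], so some
    block [T] has at most [q] elements below them. The rest of [T] is the new part: it is not below
    [Bs] by choice, not above by position, and its own downset is small in every cell of [C] because
    [T] is a block. *)
Lemma stack_step p c e C lab X F : {homo lab : a b / a <= b} -> c <= e ->
  stack p c C -> packing C (slice X c e) F -> #|F| = threshold lab c e ->
  stack p.+1 e (C ++ cells lab c e (cover F)).
Proof.
move=> labm ce st /packingP[tF hF] cF Bs sB hB pB.
pose U := \bigcup_(B <- Bs) below B.
have covF : cover F \subset slice X c e by apply/bigcupsP=> T /hF[].
have U_le : #|cover F :&: U| <= (size Bs) * (6 * q * (lab e - lab c).+1).
  apply: (@leq_trans (\sum_(B <- Bs) #|cover F :&: below B|)).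
    rewrite /U big_distrr /=.
    apply: (big_ind2 (fun (A : {set P}) n => #|A| <= n)) => // [|A m B n Am Bn].
      by rewrite cards0.
    by apply: leq_trans (leq_card_setU _ _).1 _; apply: leq_add.
  apply: leq_sum_seq_const => B /hB[_ _ hN]; rewrite setIC.
  by apply: card_cells covF _ => // N Nc; apply: hN; rewrite mem_cat Nc orbT.
(* Pigeonhole: with $L$ cells, [U] meets [cover F] in at most $6kqL$ elements, which cannot give
   more than $q$ to each of the $6kL$ blocks. *)
have [T TF TU] : exists2 T, T \in F & #|T :&: U| <= q.
  apply/exists_inP; apply: contraTT U_le; rewrite negb_exists_in -ltnNge.
  move=> /forall_inP big_TU.
  have -> : #|cover F :&: U| = \sum_(T in F) #|T :&: U|.
    rewrite -sum1_card; under eq_bigl do rewrite inE.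
    rewrite big_mkcondr big_trivIset //=; apply: eq_bigr => T _.
    by rewrite -big_mkcondr -sum1_card; apply: eq_bigl => x; rewrite inE.
  apply: (@leq_trans (\sum_(T in F) q.+1)); last first.
    by apply: leq_sum => T /big_TU; rewrite -ltnNge.
  rewrite sum_nat_const cF /threshold.
  move: (lab e - lab c).+1 (ltn0Sn (lab e - lab c)) => L L0.
  have le1 : size Bs * (6 * q * L) <= k * (6 * q * L) by rewrite leq_mul2r; lia.
  apply: leq_ltn_trans le1 _.
  have -> : k * (6 * q * L) = 6 * k * L * q by lia.
  by rewrite ltn_pmul2l ?ltnS // !muln_gt0 k_gt0.
have [/andP[/andP[T2 T3] /allP TC] TX] := hF T TF.
have sTU : below (T :\: U) \subset below T by apply: belowS; apply: subsetDl.
apply: (st ((T :\: U) :: Bs)); first by rewrite /= -sB addSnnS.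
  move=> B /predU1P[->|/[dup] BBs /hB[qB eB NB]]; last first.
    split=> // [x /eB|N NC]; first exact: leq_trans.
    by apply: NB; rewrite mem_cat NC.
  split=> [|x|N NC]; first by rewrite cardsD; lia.
    by rewrite inE => /andP[_ /(subsetP TX)]; rewrite inE => /and3P[].
  apply: leq_trans (_ : #|below T :&: N| <= _).
    by apply: subset_leq_card; apply: setSI.
  by apply: leq_trans (TC N NC) _; lia.
rewrite /= pB andbT; apply/allP=> B BBs; apply/incomparable_setsP=> x y.
rewrite inE => /andP[xU xT] yB; have [_ eB _] := hB B BBs.
have xy : idx x < idx y.
  have := subsetP TX x xT; rewrite inE => /and3P[_ _ xe].
  exact: leq_trans xe (eB y yB).
rewrite /Order.comparable negb_or !le_eqVlt !negb_or.
have nxy : x != y by apply: contraTneq xy => ->; rewrite ltnn.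
rewrite nxy eq_sym nxy /=; apply/andP; split; last first.
  by apply/negP=> /idx_mono /(ltn_trans xy); rewrite ltnn.
apply: contra xU => ltxy; rewrite /U (big_rem _ BBs) inE.
by apply/orP; left; apply/belowP; exists y.
Qed.

(** Induction on the number [n] of runs still allowed. With none left, the stack applied to the
    empty list is already contradictory. Otherwise a run either reaches [top] and ends the stage, or
    meets its threshold and the next one starts at [e]. A run loses its packing and fewer than about
    [2 * q] further elements; the label differences telescope over the runs. *)
Lemma stage_from n p c C lab X : p + n = k -> {homo lab : a b / a <= b} ->
  c <= top -> stack p c C ->
  exists X' lab' C',
    [/\ X' \subset slice X c top,
        #|slice X c top :\: X'| <= 18 * k * q * (lab top - lab c + n) + 2 * q * n,
        {homo lab' : a b / a <= b} & forall a, p <= lab' a <= k] /\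
    [/\ {subset C <= C'},
        forall N, N \in C' -> N \in C \/
          [/\ N \subset slice X c top, mono_on lab N & [disjoint N & X']]
      & forall A, A \subset X' -> mono_on lab' A -> 0 < #|A| <= q -> expands C' A].
Proof.
move=> + labm; elim: n p c C => [|n IHn] p c C pk ct st.
  by case: (st [::]); rewrite // addn0 in pk *.
have [e [F [/andP[ce et] pF mF F_le F_or]]] := run_exists C X labm ct.
have /packingP[tF hF] := pF.
have covF : cover F \subset slice X c e by apply/bigcupsP=> T /hF[].
have [E [ES E_le E_exp]] := expanding_remainder mF.
have sE : E \subset slice X c e by apply: subset_trans ES _; apply: subsetDl.
have runw : #|slice X c e :\: E| <= 18 * k * q * (lab e - lab c).+1 + 2 * q.
  have cov_le : #|cover F| <= #|F| * (3 * q).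
    apply: leq_trans (leq_card_cover F).1 _; rewrite -sum_nat_const leq_sum // => T.
    by move=> /hF[/andP[/andP[]]].
  apply: (@leq_trans (#|cover F| + 2 * q)); last first.
    rewrite leq_add2r (leq_trans cov_le) //.
    rewrite (_ : 18 * k * q * _ = threshold lab c e * (3 * q)) ?leq_mul2r ?F_le ?orbT //.
    by rewrite /threshold; lia.
  apply: leq_trans (_ : #|cover F :|: (slice X c e :\: cover F :\: E)| <= _).
    apply: subset_leq_card; apply/subsetP=> x.
    by rewrite in_setU !in_setD; case: (x \in cover F) => //=; case: (x \in E).
  by apply: leq_trans (leq_card_setU _ _).1 _; rewrite leq_add2l.
have le_et := labm _ _ et; have le_ce := labm _ _ ce.
case: F_or => [F_eq|e_top]; last first.
  rewrite e_top in sE runw *; exists E, (fun=> p), C; split; split=> //.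
  - by apply: leq_trans runw _; nia.
  - by move=> a; rewrite leqnn -pk leq_addr.
  - by move=> N; left.
  - by move=> A AE _; apply: E_exp.
have st' := stack_step labm ce st pF F_eq.
have [X' [lab' [C' [[sX' X'_le lab'm lab'_in] [CC' hC' X'_exp]]]]] :=
  IHn p.+1 e _ (etrans (addSnnS p n) pk) et st'.
have dX' : [disjoint slice X c e & X'].
  apply/pred0P=> x; apply/negbTE/negP=> /andP[/=]; rewrite inE => /and3P[_ _ xe].
  by move=> /(subsetP sX'); rewrite inE => /and3P[_ ex _]; rewrite ltnNge ex in xe.
have slice_split : slice X c top = slice X c e :|: slice X e top.
  by apply/setP=> x; rewrite !inE; case: (x \in X) => //=; lia.
(* The present run becomes batch [p] and all later batches have larger labels. Hence the new
   labelling is monotone, and a set inside one batch lies entirely on one side of [e]. *)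
exists (E :|: X'), (fun a => if a < e then p else lab' a), C'.
split; split.
- by rewrite slice_split setUSS.
- apply: leq_trans (_ : #|(slice X c e :\: E) :|: (slice X e top :\: X')| <= _).
    apply: subset_leq_card; rewrite slice_split; apply/subsetP=> x.
    rewrite !in_setU !in_setD in_setU negb_or => /andP[/andP[-> ->]] /=.
    by rewrite in_setU.
  apply: leq_trans (leq_card_setU _ _).1 _; apply: leq_trans (leq_add runw X'_le) _.
  have -> : lab top - lab c + n.+1 = (lab e - lab c).+1 + (lab top - lab e + n) by lia.
  by lia.
- move=> a b ab; case: ltnP => ae; case: ltnP => be //.
  + by have /andP[/ltnW] := lab'_in b.
  + by rewrite ltnNge (leq_trans ae ab) in be.
  + exact: lab'm.
- move=> a; case: ltnP => _; first by rewrite leqnn -pk leq_addr.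
  by have /andP[/ltnW-> ->] := lab'_in a.
- by move=> N NC; apply: CC'; rewrite mem_cat NC.
- move=> N /hC'[|[sN monoN dN]]; last first.
    right; split=> //; first by rewrite slice_split (subset_trans sN) ?subsetUr.
    apply/pred0P=> x; apply/negbTE/negP=> /andP[/= xN]; rewrite inE => /orP[xE|xX'].
      have := subsetP sN x xN; have := subsetP sE x xE.
      by rewrite !inE => /and3P[_ _ xe] /and3P[_ ex _]; rewrite ltnNge ex in xe.
    by move/pred0P: dN => /(_ x); rewrite /= xN xX'.
  rewrite mem_cat => /orP[]; first by left.
  case/mapP=> i _ ->; right; have sN : [set x in cover F | lab (idx x) == i] \subset cover F.
    by apply/subsetP=> x; rewrite inE => /andP[].
  split.
  + by rewrite slice_split (subset_trans (subset_trans sN covF)) ?subsetUl.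
  + by move=> x y; rewrite !inE => /andP[_ /eqP->] /andP[_ /eqP->].
  apply/pred0P=> x; apply/negbTE/negP=> /andP[/= /(subsetP sN) xN].
  rewrite inE => /orP[/(subsetP ES)|xX']; first by rewrite inE xN.
  by move/pred0P: dX' => /(_ x); rewrite /= xX' (subsetP covF).
- move=> A /subsetP AX' monoA /[dup] cA /andP[/card_gt0P[x xA] _].
  have AT y : y \in A -> (y \in E) = (idx y < e) /\ (y \in X') = ~~ (idx y < e).
    move=> /AX'; rewrite inE; have := subsetP sE y; have := subsetP sX' y.
    rewrite !inE; case: (y \in E); case: (y \in X') => //=.
    + by move=> /(_ isT)/and3P[_ ey _] /(_ isT)/and3P[_ _]; rewrite ltnNge ey.
    + by move=> _ /(_ isT)/and3P[_ _ ->].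
    + by move=> /(_ isT)/and3P[_ ey _] _ _; rewrite ltnNge ey.
  have side y : y \in A -> (idx y < e) = (idx x < e).
    move=> yA; have := monoA x y xA yA; case: ltnP => xe; case: ltnP => ye //.
      by move=> e1; have := lab'_in (idx y); rewrite -e1 ltnn.
    by move=> e1; have := lab'_in (idx x); rewrite e1 ltnn.
  have [xe|xe] := ltnP (idx x) e.
    apply: (@expands_sub C); first by move=> N NC; apply: CC'; rewrite mem_cat NC.
    apply: E_exp => //; apply/subsetP=> y yA.
    by rewrite (AT y yA).1 (side y yA).
  apply: X'_exp => //.
    by apply/subsetP=> y yA; rewrite (AT y yA).2 (side y yA) -leqNgt.
  move=> y z yA zA; have := monoA y z yA zA.
  by rewrite (side y yA) (side z zA) ltnNge xe.
Qed.

(** * Stages and their iteration *)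

Definition loss := 38 * k ^ 2 * q.

(* Only subsets of a single batch of [X'] expand into the cells, so the cells
   must themselves be contained in single batches for stages to be composable. *)
Lemma stage lab X : cofree P k q -> {homo lab : a b / a <= b} ->
  (forall a, lab a <= k) ->
  exists X' lab' C',
    [/\ X' \subset X, #|X :\: X'| <= loss,
        {homo lab' : a b / a <= b} & forall a, lab' a <= k] /\
    (forall N, N \in C' -> [/\ N \subset X, mono_on lab N & [disjoint N & X']]) /\
    (forall A, A \subset X' -> mono_on lab' A -> 0 < #|A| <= q -> expands C' A).
Proof.
move=> free labm lab_le.
have [X' [lab' [C' [[sX' X'_le lab'm lab'_in] [_ hC' X'_exp]]]]] :=
  stage_from X (add0n k) labm (leq0n top) (stack0 free).
have sX : slice X 0 top = X.
  by apply/setP=> x; rewrite inE idx_top !andbT.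
rewrite sX in sX' X'_le hC'; exists X', lab', C'; split; [split|split] => //.
(* The labels and the number of runs are both at most $k$, which gives $36k^2q$ for the packings and
   $2k^2q$ for the remainders. *)
- apply: leq_trans X'_le _; rewrite /loss.
  have : 18 * k * q * (lab top - lab 0 + k) <= 18 * k * q * (k + k).
    by rewrite leq_mul2l leq_add2r (leq_trans (leq_subr _ _)) ?lab_le ?orbT.
  have : 2 * q * k <= 2 * q * (k * k) by rewrite leq_mul2l leq_pmull ?orbT.
  by rewrite expnS expn1; lia.
- by move=> N /hC'[].
Qed.

(** Capping at [q] before multiplying by [e] does not weaken the capped product; this lets the
    growth estimate pass through a trimmed set. *)
Lemma minn_double e a : 0 < e ->
  minn (2 * e * a) q <= minn (e * minn (2 * a) q) q.
Proof.
move=> e_gt0; rewrite leq_min geq_minr andbT.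
have [aq|qa] := leqP (2 * a) q; first by rewrite mulnCA mulnA geq_minl.
by rewrite (leq_trans (geq_minr _ _)) // leq_pmull.
Qed.

(** Iterates [stage], with [W i] the union of the cells of the stage numbered [i]. A set in one
    batch doubles into a single cell, and that cell lies in a single batch of the previous stage, so
    the doubling can be repeated downwards until it reaches [q]. *)
Lemma tower X r : cofree P k q -> exists (Y : {set P}) lab (W : nat -> {set P}),
    [/\ Y \subset X, #|X :\: Y| <= r * loss, {homo lab : a b / a <= b}
      & forall a, lab a <= k] /\
    [/\ forall i, i < r -> [/\ W i \subset X, #|W i| <= loss & [disjoint W i & Y]],
        forall i j, i < j < r -> [disjoint W i & W j],
        forall A i, A \subset Y -> mono_on lab A -> 0 < #|A| <= q -> i < r ->
          minn (2 ^ (r - i) * #|A|) q <= #|below A :&: W i|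
      & forall i j z, j < i < r -> z \in W i ->
          minn (2 ^ (i - j)) q <= #|below [set z] :&: W j| ].
Proof.
move=> free; elim: r => [|r [Y [lab [W [[YX Y_le labm lab_le] [W1 W2 grow Wgrow]]]]]].
  exists X, (fun=> 0), (fun=> set0); split; split=> //; first by rewrite setDv cards0.
    by move=> i j; rewrite ltn0 andbF.
  by move=> i j z; rewrite ltn0 andbF.
have [Y' [lab' [C' [[Y'Y Y'_le lab'm lab'_le] [hC' expC']]]]] := stage Y free labm lab_le.
pose U := [set x | has (fun N => x \in N) C'].
have UP x : reflect (exists2 N, N \in C' & x \in N) (x \in U).
  by rewrite inE; apply: hasP.
have UY : U \subset Y by apply/subsetP=> x /UP[N /hC'[/subsetP NY _ _]]; exact: NY.
have dU : [disjoint U & Y'].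
  apply/pred0P=> x; apply/negbTE/negP=> /andP[/= /UP[N /hC'[_ _ /pred0P/(_ x)/= dN] xN] xY'].
  by rewrite xN xY' in dN.
exists Y', lab', (fun i => if i == r then U else W i); split; split=> //.
- exact: subset_trans YX.
- apply: leq_trans (_ : #|(X :\: Y) :|: (Y :\: Y')| <= _).
    apply: subset_leq_card; apply/subsetP=> x; rewrite in_setU !in_setD.
    by case: (x \in Y); case: (x \in Y'); case: (x \in X).
  by rewrite mulSn addnC (leq_trans (leq_card_setU _ _).1) // leq_add.
- move=> i; rewrite ltnS leq_eqVlt; case: eqP => [-> _|_ /= ir].
    split=> //; first exact: subset_trans YX.
    apply: leq_trans Y'_le; apply: subset_leq_card; apply/subsetP=> x xU.
    rewrite inE (subsetP UY) // andbT.
    by apply/negP=> xY'; move/pred0P: dU => /(_ x); rewrite /= xU xY'.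
  have [WX W_le dW] := W1 i ir; split=> //; exact: disjointWr Y'Y dW.
- move=> i j /andP[ij jr]; have -> : (i == r) = false by lia.
  case: eqP => [jr'|/eqP jr']; last by apply: W2; lia.
  by have [|_ _] := W1 i; [lia | apply: disjointWr].
- move=> A i AY' monoA cA ir; have /hasP[N NC' NA] := expC' A AY' monoA cA.
  have [NY monoN _] := hC' N NC'.
  case: eqP => [->|/eqP ir'].
    rewrite subSnn expn1; apply: leq_trans (geq_minl _ _) _; apply: leq_trans (ltnW NA) _.
    by apply: subset_leq_card; apply: setIS; apply/subsetP=> x xN; apply/UP; exists N.
  (* The induction hypothesis covers only sets of at most [q] elements, so the doubled set is
     trimmed first. *)
  have [|A' A'N cA'] := @subset_of_card _ _ (below A :&: N) (minn (2 * #|A|) q).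
    by apply: leq_trans (geq_minl _ _) (ltnW NA).
  have A'Y : A' \subset N by apply: subset_trans A'N _; apply: subsetIr.
  have : minn (2 ^ (r - i) * #|A'|) q <= #|below A' :&: W i|.
    apply: grow; first exact: subset_trans NY.
    - by move=> x y xA' yA'; apply: monoN; apply: (subsetP A'Y).
    - by rewrite cA' geq_minr leq_min q_gt0 muln_gt0; case/andP: cA => ->.
    - by rewrite ltn_neqAle ir'.
  have sA' : below A' \subset below A.
    by apply: below_trans; apply: subset_trans A'N _; apply: subsetIl.
  move=> hA'; apply: leq_trans (leq_trans _ hA') (subset_leq_card (setSI _ sA')).
  by rewrite cA' (subSn (ir : i <= r)) expnS minn_double // expn_gt0.
move=> i j z /andP[ji ir]; have -> : (j == r) = false by lia.
case: eqP => [-> /UP[N NC' zN]|/eqP ir' zW]; last by apply: Wgrow => //; lia.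
have [NY _ _] := hC' N NC'.
have := grow [set z] j; rewrite cards1 muln1; apply=> //.
- by rewrite sub1set (subsetP NY).
- by move=> x y; rewrite !inE => /eqP-> /eqP->.
- exact: leq_trans ji ir.
Qed.

(** * The size of a set with short intervals *)

Definition between X y x := [set z in X | (y < z)%O && (z < x)%O].

(** If [x] survives [2 * g + n] stages, it lies above [q] elements of each of the [n] middle layers
    from [W g] on, and each of these lies above [q] elements of [W 0]: there are [g] layers of
    doubling on either side. This yields $nq^2$ pairs, whereas short intervals below [x] allow fewer
    than [loss * t]. So nothing survives and [X] is bounded by the total loss. *)
Lemma card_short_intervals X t g : cofree P k q -> 0 < g -> q <= 2 ^ g -> 0 < t ->
  {in X &, forall x y, #|between X y x| < t} ->
  #|X| <= loss * (2 * g + 1) + 1444 * k ^ 4 * t.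
Proof.
move=> free g_gt0 qg t_gt0 short.
(* The least [n] with $nq > 38k^2t$, so that $nq^2$ reaches [loss * t]. The quotient costs at most
   $38k^2t \cdot 38k^2 = 1444k^4t$. *)
pose n := (38 * k ^ 2 * t %/ q).+1.
have n_big : loss * t <= n * (q * q).
  have : 38 * k ^ 2 * t < n * q by apply: ltn_ceil.
  by rewrite /loss -(ltn_pmul2r q_gt0); lia.
have [Y [lab [W [[YX Y_le _ _] [W1 W2 grow Wgrow]]]]] := tower X (2 * g + n) free.
have loss_bound : (2 * g + n) * loss <= loss * (2 * g + 1) + 1444 * k ^ 4 * t.
  have -> : (2 * g + n) * loss =
      loss * (2 * g + 1) + (38 * k ^ 2 * t %/ q * q) * (38 * k ^ 2).
    by rewrite /n /loss; move: (_ %/ _) => m; lia.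
  have -> : 1444 * k ^ 4 * t = (38 * k ^ 2 * t) * (38 * k ^ 2).
    by rewrite (expnM k 2 2); lia.
  by rewrite leq_add2l leq_mul2r leq_trunc_div orbT.
apply: leq_trans loss_bound; apply: leq_trans Y_le; apply: subset_leq_card.
apply/subsetP=> x xX; rewrite inE xX andbT; apply/negP=> xY.
have q_le m : g <= m -> q <= minn (2 ^ m) q.
  by move=> gm; rewrite leq_min leqnn andbT (leq_trans qg) // leq_exp2l.
have Wx (i : 'I_n) : q <= #|below [set x] :&: W (g + i)|.
  have := grow [set x] (g + i); rewrite cards1 muln1 sub1set => /(_ xY).
  have mono_x : mono_on lab [set x] by move=> a b; rewrite !inE => /eqP-> /eqP->.
  have lt_i : g + i < 2 * g + n by rewrite mul2n -addnn -addnA ltn_add2l ltn_addl.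
  move=> /(_ mono_x q_gt0 lt_i); apply: leq_trans; apply: q_le.
  by rewrite mul2n -addnn -addnA subnDl -addnBA ?leq_addr // ltnW.
have Wz (i : 'I_n) z : z \in W (g + i) -> q <= #|below [set z] :&: W 0|.
  move=> zW; have lt_i : 0 < g + i < 2 * g + n.
    by rewrite addn_gt0 g_gt0 mul2n -addnn -addnA ltn_add2l ltn_addl.
  by have := Wgrow _ _ _ lt_i zW; rewrite subn0; apply: leq_trans; apply: q_le; rewrite leq_addr.
have [|W0X W0_le _] := W1 0; first by rewrite addn_gt0 muln_gt0 g_gt0.
pose pairs := \sum_(i < n) \sum_(z in below [set x] :&: W (g + i)) #|below [set z] :&: W 0|.
have pairs_ge : n * (q * q) <= pairs.
  rewrite -{1}(card_ord n) -sum_nat_const leq_sum // => i _.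
  apply: leq_trans (leq_mul (Wx i) (leqnn q)) _.
  by rewrite -sum_nat_const leq_sum // => z; rewrite inE => /andP[_]; apply: Wz.
suff : pairs < loss * t by rewrite ltnNge (leq_trans n_big).
have loss_gt0 : 0 < loss by rewrite /loss !muln_gt0 k_gt0.
apply: (@leq_ltn_trans (loss * t.-1)); last by rewrite ltn_pmul2l // ltn_predL.
apply: leq_trans (leq_mul W0_le (leqnn _)); rewrite -sum_nat_const.
have -> : pairs = \sum_(y in W 0) \sum_(i < n) #|[set z in below [set x] :&: W (g + i) | (y < z)%O]|.
  rewrite exchange_big; apply: eq_bigr => i _.
  transitivity (\sum_(z in below [set x] :&: W (g + i)) \sum_(y in W 0 | (y < z)%O) 1).
    apply: eq_bigr => z _; rewrite -sum1_card; apply: eq_bigl => y.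
    rewrite inE andbC; congr andb.
    by apply/belowP/idP => [[z']|yz]; [rewrite inE => /eqP-> | exists z; rewrite ?inE].
  rewrite (exchange_big_dep (fun y => y \in W 0)) /=; last by move=> z y _ /andP[].
  apply: eq_bigr => y yW; rewrite -sum1_card; apply: eq_bigl => z.
  by rewrite inE yW.
apply: leq_sum => y yW; have yX := subsetP W0X y yW.
rewrite -ltnS (ltn_predK t_gt0); apply: leq_ltn_trans (short x y xX yX).
under eq_bigr do rewrite -sum1_card.
(* The layers are disjoint, so each [z] between [y] and [x] is counted once. *)
rewrite -partition_disjoint_bigcup /=; last first.
  move=> i j; rewrite neq_ltn => ij.
  suff dW : [disjoint W (g + i) & W (g + j)].
    apply/pred0P=> z; apply/negbTE/negP=> /andP[/=]; rewrite !inE.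
    move=> /andP[/andP[_ zi] _] /andP[/andP[_ zj] _].
    by move/pred0P: dW => /(_ z); rewrite /= zi zj.
  have lt_m (m : 'I_n) : g + m < 2 * g + n.
    by rewrite mul2n -addnn -addnA ltn_add2l ltn_addl.
  by case/orP: ij => ij; last rewrite disjoint_sym; apply: W2; rewrite ltn_add2l ij lt_m.
rewrite sum1_card; apply: subset_leq_card; apply/subsetP=> z /bigcupP[i _].
rewrite /between !inE => /andP[/andP[/exists_inP[x']]]; rewrite inE => /eqP-> zx zW ->; rewrite zx !andbT.
have [|WX _ _] := W1 (g + i); last exact: (subsetP WX).
by rewrite mul2n -addnn -addnA ltn_add2l ltn_addl.
Qed.

End Expansion.

(** Positions are ordered by the number of elements below, which is strictly monotone, with ties
    broken by [enum_rank]; the factor [#|P|] encodes this lexicographic order in one number. *)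
Lemma linear_extension (d : Order.disp_t) (P : finPOrderType d) :
  exists (idx : P -> nat) top, [/\ injective idx,
    forall x y, (x < y)%O -> idx x < idx y & forall x, idx x < top].
Proof.
exists (fun x => #|[set y | (y < x)%O]| * #|P| + enum_rank x), (#|P|.+1 * #|P|).
split=> [x y e|x y xy|x].
- have := congr1 (modn^~ #|P|) e; rewrite /= !modnMDl !modn_small //.
  by move/ord_inj/enum_rank_inj.
- apply: (@leq_trans (#|[set z | (z < x)%O]|.+1 * #|P|)).
    by rewrite mulSn addnC ltn_add2r.
  apply: leq_trans (leq_addr _ _); rewrite leq_mul2r; apply/orP; right.
  apply: proper_card; apply/properP; split; last by exists x; rewrite !inE ?ltxx.
  by apply/subsetP=> z; rewrite !inE => zx; apply: lt_trans xy.
by rewrite mulSn addnC -addSn leq_add // leq_mul2r max_card orbT.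
Qed.

(** * Thick chains *)

Section ThickChains.
Variables (d : Order.disp_t) (P : finPOrderType d) (t beta : nat).
Hypothesis t_gt0 : 0 < t.
Hypothesis short_small : forall X : {set P},
  {in X &, forall x y, #|between X y x| < t} -> #|X| <= beta.
Implicit Types (S X : {set P}).

(** Mirsky's peeling: the elements [M] of [S0] that are minimal for the thick order have only short
    intervals, so at most [beta] of them are lost per step. The points of the chain come from the
    shrinking [S0], but the blocks are taken in the fixed set [S]. *)
Lemma thick_chain_above l S S0 : S0 \subset S -> l * beta < #|S0| ->
  exists x (B : nat -> {set P}), [/\ x \in S0,
    forall i, i < l -> [/\ B i \subset S, #|B i| = t & {in B i, forall z, (x < z)%O}] &
    forall i j, i < j < l -> {in B i & B j, forall z z', (z < z')%O}].
Proof.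
elim: l S0 => [|l IHl] S0 S0S big_S0.
  have [x xS0] : exists x, x \in S0 by apply/card_gt0P.
  by exists x, (fun=> set0); split=> // i j; rewrite ltn0 andbF.
pose thick y x := (y < x)%O && (t <= #|between S y x|).
pose M := [set x in S0 | [forall y in S0, ~~ thick y x]].
have M_le : #|M| <= beta.
  apply: short_small => x y; rewrite !inE => /andP[xS0 /forall_inP hx] /andP[yS0 _].
  have [yx|nyx] := boolP (y < x)%O; last first.
    rewrite (_ : between M y x = set0) ?cards0 //; apply/setP=> z.
    by rewrite !inE; apply/negP=> /andP[_ /andP[yz zx]]; rewrite (lt_trans yz zx) in nyx.
  have := hx y yS0; rewrite /thick yx -ltnNge; apply: leq_ltn_trans.
  apply: subset_leq_card; apply/subsetP=> z; rewrite !inE -!andbA.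
  by move=> /and4P[/(subsetP S0S)-> _ -> ->].
have [||x [B [xSM B1 B2]]] := IHl (S0 :\: M).
- by apply: subset_trans S0S; apply: subsetDl.
- have MS0 : M \subset S0 by apply/subsetP=> z; rewrite inE => /andP[].
  by rewrite cardsD (setIidPr MS0) ltn_subRL (leq_ltn_trans _ big_S0) // mulSn leq_add2r.
have [xS0 [y yS0 /andP[yx cyx]]] : x \in S0 /\ exists2 y, y \in S0 & thick y x.
  move: xSM; rewrite !inE => /andP[nM xS0]; split=> //; move: nM; rewrite xS0 /=.
  by rewrite negb_forall_in => /exists_inP[y yS0 /negPn h]; exists y.
have [B0 B0S cB0] := subset_of_card cyx.
have B0P z : z \in B0 -> [/\ z \in S, (y < z)%O & (z < x)%O].
  by move=> /(subsetP B0S); rewrite inE => /and3P[].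
exists y, (fun i => if i is i'.+1 then B i' else B0); split=> //.
  move=> [_|i /B1[BS cB hB]]; split=> //.
  - by apply/subsetP=> z /B0P[].
  - by move=> z /B0P[].
  by move=> z /hB; apply: lt_trans.
move=> [|i] [|j] //= ij z z'; last exact: B2.
by move=> /B0P[_ _ zx] zB; have [_ _ /(_ z' zB)] := B1 j ij; apply: lt_trans.
Qed.

Definition blocks_union h l (B : nat -> nat -> {set P}) :=
  [set z | [exists a : 'I_h, exists i : 'I_l, z \in B a i]].

Lemma blocks_unionP h l (B : nat -> nat -> {set P}) z :
  reflect (exists a i, [/\ a < h, i < l & z \in B a i]) (z \in blocks_union h l B).
Proof.
rewrite inE; apply: (iffP existsP) => [[a /existsP[i zB]]|[a [i [ah il zB]]]].
  by exists a, i.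
by exists (Ordinal ah); apply/existsP; exists (Ordinal il).
Qed.

(** Thick chains are removed greedily while more than [l * beta] elements remain; each removal is
    nonempty, so the process ends. *)
Lemma thick_chain_packing l S : 0 < l -> exists h (B : nat -> nat -> {set P}),
  [/\ forall a i, a < h -> i < l -> B a i \subset S /\ #|B a i| = t,
      forall a i j, a < h -> i < j < l -> {in B a i & B a j, forall z z', (z < z')%O},
      forall a b i j, a < b < h -> i < l -> j < l -> [disjoint B a i & B b j]
    & #|S :\: blocks_union h l B| <= l * beta].
Proof.
move=> l_gt0; have [n] := ubnP #|S|; elim: n S => // n IHn S Sn.
have [S_le|S_gt] := leqP #|S| (l * beta).
  exists 0, (fun _ _ => set0); split=> //.
    by move=> a b i j; rewrite ltn0 andbF.
  by apply: leq_trans S_le; apply: subset_leq_card; apply: subsetDl.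
have [x [B0 [_ B0S B0lt]]] := thick_chain_above (subxx S) S_gt.
pose U := blocks_union 1 l (fun=> B0).
have UP z : reflect (exists2 i, i < l & z \in B0 i) (z \in U).
  apply: (iffP (blocks_unionP 1 l (fun=> B0) z)) => [[a [i [_ il zB]]]|[i il zB]].
    by exists i.
  by exists 0, i.
have [|h [B [B1 B2 B3 B4]]] := IHn (S :\: U).
  rewrite ltnS in Sn; apply: leq_trans Sn; apply: proper_card.
  have [B00 cB0 _] := B0S 0 l_gt0.
  have /card_gt0P[z zB] : 0 < #|B0 0| by rewrite cB0.
  apply/properP; split; first exact: subsetDl.
  exists z; first exact: (subsetP B00).
  by rewrite inE negb_and negbK; apply/orP; left; apply/UP; exists 0.
exists h.+1, (fun a => if a is a'.+1 then B a' else B0); split.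
- move=> [_ i /B0S[]|a i ah il] //; have [BS cB] := B1 a i ah il; split=> //.
  by apply: subset_trans BS _; apply: subsetDl.
- by move=> [|a] i j ah ij; [apply: B0lt | apply: B2].
- move=> [|a] [|b] i j //= ab il jl; last exact: B3.
  apply/pred0P=> z; apply/negbTE/negP=> /andP[/= zB0 zB].
  have [/subsetP /(_ z zB)] := B1 b j ab jl; rewrite inE => /andP[/negP[]].
  by apply/UP; exists i.
apply: leq_trans B4; apply: subset_leq_card; apply/subsetP=> z.
rewrite !in_setD => /andP[nz zS]; rewrite zS andbT -negb_or; apply: contra nz.
case/orP=> [/blocks_unionP[a [i [ah il zB]]]|/UP[i il zB]].
  by apply/blocks_unionP; exists a.+1, i.
by apply/blocks_unionP; exists 0, i.
Qed.

End ThickChains.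

(** * Counting inhomogeneous pairs of blocks *)

Section Partition.
Variables (d : Order.disp_t) (P : finPOrderType d).
Local Notation G := (incomparability_graph P).

Lemma comparable_homogeneous (A B : {set P}) :
  {in A & B, forall x y, (x >=< y)%O} -> homogeneous (A : {set G}) B.
Proof.
move=> h; apply/orP; left; apply/forall_inP=> x xA; apply/forall_inP=> y yB.
by apply/negPn; apply: h.
Qed.

Lemma inhomogeneous_comparable (A B : {set P}) : [disjoint A & B] ->
  ~~ homogeneous (A : {set G}) B ->
  exists x y, [/\ x \in A, y \in B & (x < y)%O || (y < x)%O].
Proof.
move=> dAB; rewrite negb_or => /andP[_]; rewrite negb_forall_in => /exists_inP[x xA].
rewrite negb_forall_in => /exists_inP[y yB /negPn xy]; exists x, y; split=> //.
have nxy : x != y.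
  by apply: contraTneq xA => xy'; rewrite (disjointFl dAB) // xy'.
by move: xy; rewrite /Order.comparable !le_eqVlt [y == x]eq_sym (negPf nxy).
Qed.

(** With $h$ chains of $l$ blocks, $m = hl$. An inhomogeneous pair is determined by a direction of
    comparison, its two chains and the sum of its block indices, which leaves at most $2 \cdot h^2
    \cdot 2l = 4m^2/l$ pairs. *)
Lemma homogeneous_partition t beta l : 0 < t -> 0 < l ->
  (forall X : {set P}, {in X &, forall x y, #|between X y x| < t} -> #|X| <= beta) ->
  exists m (V : 'I_m.+1 -> {set G}),
    [/\ \bigcup_i V i = [set: G], forall i j, i != j -> [disjoint V i & V j],
        #|V ord0| <= l * beta, forall i, i != ord0 -> #|V i| = t
      & l * #|[set p : 'I_m.+1 * 'I_m.+1 |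
               (0 < p.1 < p.2) && ~~ homogeneous (V p.1) (V p.2)]| <= 4 * m ^ 2].
Proof.
move=> t_gt0 l_gt0 short.
have [h [B [B1 B2 B3 B4]]] := thick_chain_packing t_gt0 short [set: P] l_gt0.
pose W n := if n is n'.+1 then B (n' %/ l) (n' %% l) else [set: P] :\: blocks_union h l B.
have div_lt n : n < h * l -> n %/ l < h by rewrite ltn_divLR.
have mod_lt n : n %% l < l by rewrite ltn_mod.
have add_lt m n : m %% l + n %% l < l + l by rewrite -addSn leq_add ?mod_lt // ltnW.
have dB a b i j : a < h -> b < h -> i < l -> j < l -> (a, i) != (b, j) ->
    [disjoint B a i & B b j].
  move=> ah bh il jl; rewrite xpair_eqE negb_and.
  case: (ltngtP a b) => [ab _|ba _|-> /= ij].
  - by apply: B3; rewrite ?ab.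
  - by rewrite disjoint_sym; apply: B3; rewrite ?ba.
  wlog {ij} ij : i j il jl / i < j => [wl|].
    move: ij; rewrite neq_ltn => /orP[]; first exact: wl.
    by move=> ij; rewrite disjoint_sym; apply: wl.
  apply/pred0P=> z; apply/negbTE/negP=> /andP[/= zi zj].
  by have := B2 b i j bh; rewrite ij jl => /(_ isT z z zi zj); rewrite ltxx.
have dW m n : m <= h * l -> n <= h * l -> m != n -> [disjoint W m & W n].
  wlog mn : m n / m < n => [wl ml nl|].
    rewrite neq_ltn => /orP[mn|nm]; first by apply: wl; rewrite // neq_ltn mn.
    by rewrite disjoint_sym; apply: wl; rewrite // neq_ltn nm.
  case: n mn => // n; case: m => [_|m mn] ml nl _ /=.
    apply/pred0P=> z; apply/negbTE/negP=> /andP[/=].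
    rewrite inE => /andP[/negP nz _] zB; apply: nz; apply/blocks_unionP.
    by exists (n %/ l), (n %% l); rewrite div_lt.
  apply: dB; rewrite ?div_lt //; apply: contraTneq mn => -[e1 e2].
  by rewrite (divn_eq m l) e1 e2 -divn_eq ltnn.
exists (h * l), (fun i => W i); split.
- apply/setP=> z; rewrite [RHS]inE; apply/bigcupP.
  have [/blocks_unionP[a [i [ah il zB]]]|nz] := boolP (z \in blocks_union h l B).
    have lt_ai : (a * l + i).+1 < (h * l).+1.
      rewrite ltnS; apply: (@leq_trans (a.+1 * l)); first by rewrite mulSn addnC ltn_add2r.
      by rewrite leq_mul2r ah orbT.
    exists (Ordinal lt_ai) => //=.
    by rewrite divnMDl // modnMDl divn_small // modn_small // addn0.
  by exists ord0; rewrite // /W /= in_setD nz in_setT.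
- by move=> i j ij; apply: dW; rewrite // -ltnS.
- exact: B4.
- move=> [[|n] nl] //= _; have [] // := B1 (n %/ l) (n %% l) (div_lt n nl) (mod_lt n).
set Q := [set p | _]; have [->|[p0 p0Q]] := set_0Vmem Q; first by rewrite cards0 muln0.
have hl_gt0 : 0 < h * l.
  move: p0Q; rewrite inE => /andP[/andP[p1 p2] _].
  by have := ltn_ord p0.2; rewrite ltnS; apply: leq_trans; apply: leq_ltn_trans p2.
have h_gt0 : 0 < h by move: hl_gt0; rewrite muln_gt0 => /andP[].
pose up (p : 'I_(h * l).+1 * 'I_(h * l).+1) := [exists x in W p.1, exists y in W p.2, (x < y)%O].
(* Part 0 is the remainder, so part indices are shifted down by one before division by [l]. The
   ordinal bounds are written as successors for [inord]. *)
pose code (p : 'I_(h * l).+1 * 'I_(h * l).+1) : bool * ('I_h.-1.+1 * 'I_h.-1.+1 * 'I_(l + l).-1.+1) :=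
  (up p, (inord (p.1.-1 %/ l), inord (p.2.-1 %/ l), inord (p.1.-1 %% l + p.2.-1 %% l))).
suff code_inj : {in Q &, injective code}.
  have : #|Q| <= 2 * (h * h * (l + l)).
    rewrite -(card_in_imset code_inj); apply: leq_trans (max_card _) _.
    by rewrite !card_prod card_bool !card_ord !prednK ?addn_gt0 ?l_gt0.
  by rewrite -(leq_pmul2l l_gt0) => /leq_trans; apply; rewrite expnMn; lia.
have QP p : p \in Q -> exists u v : nat, [/\ p.1 = u.+1 :> nat, p.2 = v.+1 :> nat,
    u < h * l, v < h * l & ~~ homogeneous (W p.1 : {set G}) (W p.2) /\ [disjoint W p.1 & W p.2]].
  rewrite inE => /andP[/andP[p1 p12] np].
  exists p.1.-1, p.2.-1; have p2 := ltn_trans p1 p12.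
  have lt1 := ltn_ord p.1; have lt2 := ltn_ord p.2; split; rewrite ?prednK //.
  by split=> //; apply: dW; rewrite // neq_ltn p12.
(* Equal codes and equal first block indices give equal pairs. In the remaining case, equal sums
   force the first and second indices to differ in opposite directions. *)
suff key p p' : p \in Q -> p' \in Q -> code p = code p' ->
    p.1.-1 %% l < p'.1.-1 %% l -> False.
  move=> p p' pQ p'Q e; have [lt|lt|e1] := ltngtP (p.1.-1 %% l) (p'.1.-1 %% l).
  - by case: (key p p').
  - by case: (key p' p).
  have [u [v [pu pv ul vl _]]] := QP p pQ; have [u' [v' [p'u p'v u'l v'l _]]] := QP p' p'Q.
  move: e e1; rewrite /code pu pv p'u p'v /= => -[_ /(congr1 (@nat_of_ord _)) ea].
  move=> /(congr1 (@nat_of_ord _)) eb /(congr1 (@nat_of_ord _)) ec e1.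
  rewrite !inordK ?prednK ?div_lt // in ea eb.
  rewrite !inordK ?prednK ?addn_gt0 ?l_gt0 ?add_lt // in ec.
  move: ec; rewrite e1 => /addnI e2.
  case: p p' pu pv p'u p'v {pQ p'Q} => p1 p2 [p1' p2'] /= pu pv p'u p'v.
  congr pair; apply: val_inj => /=.
    by rewrite pu p'u (divn_eq u l) (divn_eq u' l) ea e1.
  by rewrite pv p'v (divn_eq v l) (divn_eq v' l) eb e2.
move=> pQ p'Q; have [u [v [pu pv ul vl [np dp]]]] := QP p pQ.
have [u' [v' [p'u p'v u'l v'l [np' dp']]]] := QP p' p'Q.
rewrite /code pu pv p'u p'v /= => -[eup /(congr1 (@nat_of_ord _)) ea].
move=> /(congr1 (@nat_of_ord _)) eb /(congr1 (@nat_of_ord _)) ec lt_i.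
rewrite !inordK ?prednK ?div_lt // in ea eb.
rewrite !inordK ?prednK ?addn_gt0 ?l_gt0 ?add_lt // in ec.
have lt_j : v' %% l < v %% l.
  by rewrite -(ltn_add2l (u' %% l)) -ec ltn_add2r.
have Bu x x' : x \in B (u %/ l) (u %% l) -> x' \in B (u %/ l) (u' %% l) -> (x < x')%O.
  by apply: B2; rewrite ?div_lt // lt_i mod_lt.
have Bv y y' : y' \in B (v %/ l) (v' %% l) -> y \in B (v %/ l) (v %% l) -> (y' < y)%O.
  by move=> yB y'B; apply: (B2 _ _ _ (div_lt v vl)) yB y'B; rewrite lt_j mod_lt.
rewrite pu pv /= in np dp; rewrite p'u p'v /= -ea -eb in np' dp'.
(* If the comparisons go up, one in [p'] propagates to all of [p], whose first block is lower and
   whose second block is higher in the same chains. *)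
have [up_p|nup_p] := boolP (up p).
  move: eup; rewrite up_p => /esym/exists_inP[x]; rewrite p'u /= -ea => xB /exists_inP[y].
  rewrite p'v /= -eb => yB xy; move/negP: np; apply; apply: comparable_homogeneous => x0 y0 x0B y0B.
  apply: lt_comparable; apply: lt_trans (Bu _ _ x0B xB) _.
  by apply: lt_trans xy _; apply: Bv.
(* Otherwise [p] contains a downward comparison, which propagates to all of [p']. *)
have [x [y [xB yB xy]]] := inhomogeneous_comparable dp np.
have yx : (y < x)%O.
  case/orP: xy => // xy; case/negP: nup_p; apply/exists_inP; exists x; rewrite ?pu //.
  by apply/exists_inP; exists y; rewrite ?pv.
move/negP: np'; apply; apply: comparable_homogeneous => x0 y0 x0B y0B.
rewrite comparable_sym; apply: lt_comparable; apply: lt_trans (Bv _ _ y0B yB) _.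
by apply: lt_trans yx _; apply: Bu.
Qed.

End Partition.

Import GRing.Theory Num.Theory.

(** * The regularity partition *)

Lemma cofree_of_no_copy (d : Order.disp_t) (P : finPOrderType d) k q :
  0 < k -> 0 < q ->
  ~ has_copy (complete_multipartite k q) (incomparability_graph P) -> cofree P k q.
Proof.
move=> k_gt0 q_gt0 nocopy Bs sB /allP cB /(pairwiseP set0) inc; apply: nocopy.
pose N (i : 'I_k) := nth set0 Bs i.
have cN i : q <= #|N i| by apply/cB/mem_nth; rewrite sB.
have /card_gt0P[x0 _] : 0 < #|N (Ordinal k_gt0)| by apply: leq_trans (cN _).
pose f (u : 'I_k * 'I_q) := nth x0 (enum (N u.1)) u.2.
have fN u : f u \in N u.1.
  by rewrite -mem_enum mem_nth // -cardE (leq_trans _ (cN u.1)).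
have f_inc u v : u.1 != v.1 -> (f u >< f v)%O.
  wlog uv : u v / u.1 < v.1 => [wl|_].
    rewrite neq_ltn => /orP[uv|vu]; first by apply: wl; rewrite // neq_ltn uv.
    by rewrite comparable_sym; apply: wl; rewrite // neq_ltn vu.
  have inc_uv : incomparable_sets (N u.1) (N v.1) by apply: inc; rewrite ?inE ?sB.
  exact: (incomparable_setsP _ _ inc_uv).
exists f => // u v e; have [uv|/f_inc] := eqVneq u.1 v.1; last by rewrite e comparablexx.
case: u v uv e => i a [j b] /= <- /eqP; rewrite /f /= nth_uniq ?enum_uniq //.
- by move/eqP/ord_inj => ->.
- by rewrite -cardE (leq_trans _ (cN i)).
- by rewrite -cardE (leq_trans _ (cN i)).
Qed.

(** $K_k[0]$ has no vertices and embeds in every graph. *)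
Lemma no_copy_gt0 (G : sgraph) k q :
  ~ has_copy (complete_multipartite k q) G -> 0 < q.
Proof.
case: q => // nocopy; case: nocopy.
have void (u : 'I_k * 'I_0) : False by case: u => _ [].
by exists (fun u => False_rect _ (void u)) => u; case: (void u).
Qed.

Local Open Scope ring_scope.

Lemma trunc_log_le_ln (R : realType) n : (0 < n)%N ->
  (trunc_log 2 n)%:R <= 2 * ln n%:R :> R.
Proof.
move=> n_gt0; have n_gt0' : 0 < n%:R :> R by rewrite ltr0n.
have ln2 : 1 / 2 <= ln 2 :> R.
  have : ln (1 + - (1 / 2)) <= - (1 / 2) :> R by apply: le_ln1Dx; lra.
  rewrite (_ : 1 + - (1 / 2) = 2^-1); last by field.
  by rewrite lnV ?posrE // lerN2.
have : ln ((2 ^ trunc_log 2 n)%:R) <= ln n%:R :> R.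
  by rewrite ler_ln ?posrE ?ltr0n ?expn_gt0 // ler_nat trunc_logP.
rewrite natrX lnXn // -(mulr_natr (ln 2)) => h.
have := ler0n R (trunc_log 2 n); nra.
Qed.

(** All powers of $\varepsilon$ are weakened to $\varepsilon^2$. The two terms are then at most $38
    \cdot 7/10^5$ and $1444/10^{11}$ times $\varepsilon^2 n$, together below the $\varepsilon^2 n/5$
    that the factor $l \le 5/\varepsilon$ permits. *)
Lemma bound_small (R : realType) (eps : R) (k l n q t : nat) :
  (0 < k)%N -> 0 < eps < 1 -> l%:R <= 5 / eps -> 1 <= ln n%:R :> R -> (0 < n)%N ->
  q%:R <= eps ^+ 4 * n%:R / (10 ^+ 5 * k%:R ^+ 2 * ln n%:R) ->
  t%:R <= eps ^+ 7 * n%:R / (10 ^+ 11 * k%:R ^+ 5) ->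
  (l * (loss k q * (2 * (trunc_log 2 n).+1 + 1) + 1444 * k ^ 4 * t))%:R <= eps * n%:R.
Proof.
move=> k_gt0 /andP[e_gt0 e_lt1] l_le ln_ge1 n_gt0.
have := trunc_log_le_ln R n_gt0.
have k_ge1 : 1 <= k%:R :> R by rewrite ler1n.
have e_le m : eps ^+ m.+2 <= eps ^+ 2.
  by rewrite -addn2 exprD ler_piMl ?exprn_ge0 ?exprn_ile1 // ltW.
rewrite /loss -(addn1 (trunc_log 2 n)) !(natrM, natrD, natrX).
move: (trunc_log 2 n) (e_le 2%N) (e_le 5%N) l_le ln_ge1 => g e4 e7.
have := ler0n R n; have := ler0n R q; have := ler0n R t; have := ler0n R l; have := ler0n R g.
move: (n%:R : R) (q%:R : R) (t%:R : R) (l%:R : R) (g%:R : R) => N Q T M G.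
move: (ln N) => L G0 M0 T0 Q0 N0 M_le L1 GL.
rewrite !ler_pdivlMr //; do ?[by rewrite ?mulr_gt0 ?exprn_gt0 // (lt_le_trans ltr01)].
move: (k%:R : R) k_ge1 => K K1 hQ hT.
have N2 : eps ^+ 4 * N <= eps ^+ 2 * N by rewrite ler_wpM2r.
have N7 : eps ^+ 7 * N <= eps ^+ 2 * N by rewrite ler_wpM2r.
have K0 : 0 <= K by apply: le_trans K1.
have hQ' : K ^+ 2 * Q * (2 * (G + 1) + 1) <= 7 / 10 ^+ 5 * (eps ^+ 2 * N).
  (* $2G \le 4L$ comes from the logarithm estimate, and $3 \le 3L$ from $L \ge 1$. *)
  have le7 : 2 * (G + 1) + 1 <= 7 * L by lra.
  have := ler_wpM2l (mulr_ge0 (exprn_ge0 2 K0) Q0) le7; lra.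
have hT' : K ^+ 4 * T <= 1 / 10 ^+ 11 * (eps ^+ 2 * N).
  have := ler_wpM2r T0 (ler_wpM2l (exprn_ge0 4 K0) K1); lra.
have Me : M * eps <= 5 by rewrite -ler_pdivlMr.
have eN0 : 0 <= eps * N by rewrite mulr_ge0 // ltW.
apply: (@le_trans _ _ (M * (eps ^+ 2 * N / 5))).
  by rewrite ler_wpM2l //; have := mulr_ge0 (ltW e_gt0) eN0; lra.
by have := ler_wpM2r eN0 Me; lra.
Qed.

Theorem theorem1p7 (R : realType) (k : nat) (eps : R) :
  (2 <= k)%N -> 0 < eps < 1 ->
  exists n0 : nat, forall n : nat, (n0 <= n)%N ->
    let q := Num.truncn
      (eps ^+ 4 * n%:R / (10 ^+ 5 * k%:R ^+ 2 * ln n%:R)) in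
    let t := Num.truncn
      (eps ^+ 7 * n%:R / (10 ^+ 11 * k%:R ^+ 5)) in
    forall (d : Order.disp_t) (P : finPOrderType d),
      let G := incomparability_graph P in
      #|G| = n ->
      ~ has_copy (complete_multipartite k q) G ->
      exists (m : nat) (V : 'I_m.+1 -> {set G}),
        [/\ \bigcup_i V i = [set: G],
            forall i j, i != j -> [disjoint V i & V j],
            #|V ord0|%:R <= eps * n%:R,
            forall i, i != ord0 -> #|V i| = t
          & #|[set p : 'I_m.+1 * 'I_m.+1 |
                 (0 < p.1 < p.2)%N && ~~ homogeneous (V p.1) (V p.2)]|%:R
              <= eps * m%:R ^+ 2].
Proof.
move=> k_ge2 /[dup] eps01 /andP[eps_gt0 eps_lt1].
have k_gt0 : (0 < k)%N by apply: ltn_trans k_ge2.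
have k_gt0' : 0 < k%:R :> R by rewrite ltr0n.
(* Larger than $4/\varepsilon$, so that $4m^2/l \le \varepsilon m^2$, yet at most $5/\varepsilon$
   since $\varepsilon < 1$. *)
pose l := (Num.truncn (4 / eps)).+1.
have l_gt : 4 <= eps * l%:R.
  have : 4 / eps < l%:R by apply: truncnS_gt.
  by rewrite ltr_pdivrMr // mulrC => /ltW.
have l_le : l%:R <= 5 / eps.
  have : (Num.truncn (4 / eps))%:R <= 4 / eps by rewrite truncn_le ?divr_ge0 // ltW.
  have -> : 5 / eps = 4 / eps + 1 / eps by rewrite -mulrDl -natr1.
  by rewrite /l -(natr1 (Num.truncn _)) => h; apply: lerD => //; rewrite ler_pdivlMr // mul1r ltW.
(* From $n \ge 4$ the binary logarithm is at least 2, whence $\ln n \ge 1$; the other bound makes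
   [t] positive. *)
exists (maxn 4 (Num.truncn (10 ^+ 11 * k%:R ^+ 5 / eps ^+ 7)).+1).
move=> n; rewrite geq_max => /andP[n_ge4 n_t] q t d P G cG nocopy.
have n_pos : (0 < n)%N by apply: leq_trans n_ge4.
have n_gt0 : 0 < n%:R :> R by rewrite ltr0n.
have ln_ge1 : 1 <= ln n%:R :> R.
  have := trunc_log_le_ln R n_pos.
  have : 2 <= (trunc_log 2 n)%:R :> R by rewrite ler_nat trunc_log_max.
  lra.
have t_gt0 : (0 < t)%N.
  rewrite truncn_gt0 ler_pdivlMr ?mul1r; last by rewrite mulr_gt0 ?exprn_gt0.
  rewrite [leRHS]mulrC -ler_pdivrMr ?exprn_gt0 //.
  by apply: ltW; apply: lt_le_trans (truncnS_gt _) _; rewrite ler_nat.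
have q_gt0 := no_copy_gt0 nocopy.
have q_le : q%:R <= eps ^+ 4 * n%:R / (10 ^+ 5 * k%:R ^+ 2 * ln n%:R).
  by rewrite truncn_le // divr_ge0 ?mulr_ge0 ?exprn_ge0 // ltW // (lt_le_trans ltr01).
have t_le : t%:R <= eps ^+ 7 * n%:R / (10 ^+ 11 * k%:R ^+ 5).
  by rewrite truncn_le // divr_ge0 ?mulr_ge0 ?exprn_ge0 // ltW.
pose g := (trunc_log 2 n).+1.
have q_le_n : (q <= n)%N.
  rewrite -(ler_nat R); apply: le_trans q_le _.
  have D1 : 1 <= 10 ^+ 5 * k%:R ^+ 2 * ln n%:R :> R.
    by rewrite !mulr_ege1 ?exprn_ege1 ?ler1n.
  rewrite ler_pdivrMr ?(lt_le_trans ltr01) // mulrC ler_wpM2l ?ler0n //.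
  by apply: le_trans D1; rewrite exprn_ile1 // ltW.
have q_le_g : (q <= 2 ^ g)%N.
  by apply: leq_trans q_le_n _; apply: ltnW; apply: trunc_log_ltn.
have free := cofree_of_no_copy k_gt0 q_gt0 nocopy.
have [idx [top [idx_inj idx_mono idx_top]]] := linear_extension P.
have short (X : {set P}) := card_short_intervals idx_inj idx_mono idx_top k_gt0 q_gt0
  (X := X) free (ltn0Sn _ : (0 < g)%N) q_le_g t_gt0.
have [m [V [Vcov Vdis V0 Vt Vhom]]] := homogeneous_partition t_gt0 (ltn0Sn _ : (0 < l)%N) short.
exists m, V; split=> //.
  apply: le_trans (bound_small k_gt0 eps01 l_le ln_ge1 _ q_le t_le); last by rewrite -(ltr0n R).
  by rewrite ler_nat.
move: Vhom; rewrite -(ler_nat R) !natrM => Vhom.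
have l_pos : 0 < l%:R :> R by rewrite ltr0n.
rewrite -(ler_pM2l l_pos); apply: le_trans Vhom _; rewrite -?mulrA.
by rewrite -expr2 [leRHS]mulrA [l%:R * eps]mulrC ler_wpM2r ?exprn_ge0 ?ler0n.
Qed.
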